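(* Let $n\ge1$. The entries of $W^{\omega_1}_{\mathrm{pol}}$ are given, for $1\le j\le k\le n+1$, by $$\binom{n}{j-1}\binom{n}{k-1}\bigl(W^{\omega_1}_{\mathrm{pol}}(\phi)\bigr)_{n+2-j,k}=\sum_{r=0}^{\min(n+1-k,\,j-1)}(k+1-j+2r)\binom{n+1}{k+r}\binom{n+1}{j-1-r}\phi_{k+r}\,\phi_{j-1-r},$$ where $\phi_0=\phi_{n+1}=1$.
   Context: $G=\mathrm{SL}(n+1,\mathbb{C})\times\mathrm{SL}(n+1,\mathbb{C})$, $H$ is the diagonal subgroup, $A=\{(t,t^{-1})\mid t\text{ diagonal in }\mathrm{SL}(n+1,\mathbb{C})\}$ and $A_c=\{(t,t^{-1})\mid t\text{ diagonal in }\mathrm{SU}(n+1)\}$. On $A$, $\phi=(\phi_1,\dots,\phi_n)$ with $\phi_i(t,t^{-1})=\binom{n+1}{i}^{-1}\sum_{j_1<\dots<j_i}t_{j_1}^2\cdots t_{j_i}^2$ (the fundamental zonal spherical functions; algebraically independent). $V=\mathbb{C}^{n+1}$ has standard orthonormal basis $e_1,\dots,e_{n+1}$. For $m=1,\dots,n+1$ the irreducible $G$-module $V_m=\bigwedge^mV\otimes\bigwedge^{n+2-m}V$ (first factor of $G$ acting on the first tensor factor, second on the second), with its standard $\mathrm{SU}(n+1)\times\mathrm{SU}(n+1)$-invariant inner product, contains $V$ exactly once on restriction to $H$; let $j_m:V\to V_m$ be an isometric $H$-equivariant embedding and $p_m=j_m^*$. For $a\in A$, $p_m\circ a\circ j_m$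 is diagonal in the basis $(e_i)$; $\Phi^{\omega_1}_0(a)$ is the $(n+1)\times(n+1)$ matrix whose $(i,m)$ entry is the scalar by which $p_m\circ a\circ j_m$ acts on $e_i$. $W^{\omega_1}_{\mathrm{pol}}$ is the $\mathrm{End}(\mathbb{C}^{n+1})$-valued polynomial in $n$ variables determined by $W^{\omega_1}_{\mathrm{pol}}(\phi(a))=\Phi^{\omega_1}_0(a)^*\,\Phi^{\omega_1}_0(a)$ for $a\in A_c$. *)

(* Defs.v *)
From HB Require Import structures.
From mathcomp Require Import all_boot all_order all_algebra.
From mathcomp Require Import sesquilinear spectral reals complex mxtens mpoly.

Set Implicit Arguments.
Unset Strict Implicit.
Unset Printing Implicit Defensive.

Import Order.TTheory GRing.Theory Num.Theory.

Local Open Scope ring_scope.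
Local Open Scope sesquilinear_scope.

(* The complex numbers are R[i] for an arbitrary R : realType, V = C^(n+1) is
   the space of column vectors 'cV_n.+1, and linear maps act by left
   multiplication of matrices. *)

(* Lambda^m V has the orthonormal basis e_S = e_(s_1) /\ ... /\ e_(s_m), where
   S = {s_1 < ... < s_m} runs over the m-subsets of the n+1 indices;
   this is the orthonormal basis for the usual inner product
   <v_1 /\ ... /\ v_m, w_1 /\ ... /\ w_m> = det (<v_i, w_j>)_(i,j). *)
Definition ext_basis (n m : nat) : {set {set 'I_n.+1}} :=
  [set S : {set 'I_n.+1} | #|S| == m].

Definition ext_dim (n m : nat) : nat := #|ext_basis n m|.

(* s_1, ..., s_m for the p-th basis vector e_S; enum lists a subset of 'I_n.+1
   increasingly. *)
Definition ext_index (n m : nat) (p : 'I_(ext_dim n m)) (i : 'I_m) : 'I_n.+1 :=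
  nth ord0 (enum (enum_val p)) i.

(* The coordinates of v_1 /\ ... /\ v_m, the v_i being the columns of M: the
   coefficient of e_S is the minor of M on the rows in S. *)
Definition wedge (R : realType) (n m : nat) (M : 'M[R[i]]_(n.+1, m)) :
    'cV[R[i]]_(ext_dim n m) :=
  \col_p \det (rowsub (@ext_index n m p) M).

(* The action of g on Lambda^m V:
   e_(s_1) /\ ... /\ e_(s_m) |-> g e_(s_1) /\ ... /\ g e_(s_m). *)
Definition ext_pow (R : realType) (n m : nat) (g : 'M[R[i]]_n.+1) :
    'M[R[i]]_(ext_dim n m) :=
  \matrix_(p, q) wedge (colsub (@ext_index n m q) g) p ord0.

(* dim V_m and the action of G on V_m = Lambda^m V (x) Lambda^(n+2-m) V, in the
   orthonormal basis of the e_S (x) e_T; elements of G are pairs of matrices of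
   determinant 1, and *t is the Kronecker product. *)
Definition V_dim (n m : nat) : nat := (ext_dim n m * ext_dim n (n + 2 - m))%N.

Definition V_act (R : realType) (n m : nat)
    (g : 'M[R[i]]_n.+1 * 'M[R[i]]_n.+1) : 'M[R[i]]_(V_dim n m) :=
  ext_pow m g.1 *t ext_pow (n + 2 - m) g.2.

(* J is an isometric embedding V -> V_m, equivariant for the diagonal H. *)
Definition isometric_H_embedding (R : realType) (n m : nat)
    (J : 'M[R[i]]_(V_dim n m, n.+1)) : Prop :=
  J ^t* *m J = 1%:M /\
  (forall h : 'M[R[i]]_n.+1, \det h = 1 -> V_act m (h, h) *m J = J *m h).

Definition in_A_c (R : realType) (n : nat)
    (a : 'M[R[i]]_n.+1 * 'M[R[i]]_n.+1) : Prop :=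
  exists t : 'M[R[i]]_n.+1,
    [/\ is_diag_mx t, t \is unitarymx, \det t = 1 & a = (t, invmx t)].

(* phi_i (t, t^-1); meaningful for 0 <= i <= n+1, and 1 on A for i = 0, n+1. *)
Definition zonal (R : realType) (n i : nat)
    (a : 'M[R[i]]_n.+1 * 'M[R[i]]_n.+1) : R[i] :=
  ('C(n.+1, i)%:R)^-1 *
  \sum_(S : {set 'I_n.+1} | #|S| == i) \prod_(l in S) a.1 l l ^+ 2.

(* The column index m : 'I_n.+1 stands for m.+1 in 1, ..., n+1.  The operator
   p_m a j_m being diagonal, the scalar by which it acts on e_i is its (i, i)
   entry. *)
Definition Phi0 (R : realType) (n : nat)
    (J : forall m : 'I_n.+1, 'M[R[i]]_(V_dim n m.+1, n.+1))
    (a : 'M[R[i]]_n.+1 * 'M[R[i]]_n.+1) : 'M[R[i]]_n.+1 :=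
  \matrix_(i, m) ((J m) ^t* *m V_act m.+1 a *m J m) i i.

(* The variable 'X_l, l : 'I_n, of a polynomial in n variables stands for
   phi_(l+1). *)
Definition is_Wpol (R : realType) (n : nat)
    (J : forall m : 'I_n.+1, 'M[R[i]]_(V_dim n m.+1, n.+1))
    (W : 'M[{mpoly R[i][n]}]_n.+1) : Prop :=
  forall a : 'M[R[i]]_n.+1 * 'M[R[i]]_n.+1, in_A_c a ->
    map_mx (fun P : {mpoly R[i][n]} => P.@[fun l : 'I_n => zonal l.+1 a]) W
    = (Phi0 J a) ^t* *m Phi0 J a.

(* phi_i as a polynomial in phi_1, ..., phi_n, for 0 <= i <= n+1, with
   phi_0 = phi_(n+1) = 1. *)
Definition phi_var (R : realType) (n i : nat) : {mpoly R[i][n]} :=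
  if i is l.+1 then
    if insub l is Some o then 'X_(o : 'I_n) else 1
  else 1.

(* Matrix entries numbered from 1. *)
Definition entry1 (T : Type) (n : nat) (W : 'M[T]_n.+1) (i j : nat) : T :=
  W (inord i.-1) (inord j.-1).

(* Main.v *)
(* Write x_l = t_l^2, let e_a be the elementary symmetric polynomials in the
   x_l, and E_a^i those in the x_l with l <> i.  Equivariance under the diagonal
   torus forces J e_i to be supported on the vectors e_S (x) e_T with i in S and
   T the complement of S \ {i}, and equivariance under signed transpositions
   forces all its nonzero coordinates to have the same modulus.  As the phases
   do not enter the diagonal entries of J^* a J, the (i, m+1) entry of Phi0 is
   t_i E_m^i / 'C(n, m).  On A_c complex conjugation inverts t, and
   prod_l x_l = 1, so the left-hand side becomes sum_i x_i E_(j-1)^i E_(k-1)^i;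
   this is evaluated by induction on j from e_(a+1) = E_(a+1)^i + x_i E_a^i.
   Finally phi(A_c) is Zariski dense in C^n: a polynomial vanishing on it
   vanishes, as a Laurent polynomial in one coordinate at a time, on the whole
   complex torus prod_l x_l = 1, which is mapped onto C^n because C is
   algebraically closed. *)

Require Import Defs.
From HB Require Import structures.
From mathcomp Require Import all_boot all_order all_algebra.
From mathcomp Require Import sesquilinear spectral reals complex mxtens mpoly.
From mathcomp Require Import fingroup perm ring zify.

Set Implicit Arguments.
Unset Strict Implicit.
Unset Printing Implicit Defensive.

Import Order.TTheory GRing.Theory Num.Theory.

Local Open Scope ring_scope.
Local Open Scope sesquilinear_scope.

(** * Identities between elementary symmetric functions *)

Section ElementarySymmetric.
Variables (F : fieldType) (n : nat).
Implicit Types (x : 'I_n.+1 -> F) (i : 'I_n.+1) (S : {set 'I_n.+1}).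

Definition elem_sym x (a : nat) : F :=
  \sum_(S : {set 'I_n.+1} | #|S| == a) \prod_(l in S) x l.

Definition elem_sym_avoid x i (a : nat) : F :=
  \sum_(S : {set 'I_n.+1} | (i \notin S) && (#|S| == a)) \prod_(l in S) x l.

Lemma sum_setU1 i (a : nat) (G : {set 'I_n.+1} -> F) :
  \sum_(S : {set 'I_n.+1} | (i \in S) && (#|S| == a.+1)) G S =
  \sum_(S : {set 'I_n.+1} | (i \notin S) && (#|S| == a)) G (i |: S).
Proof.
rewrite (reindex_onto (fun S => i |: S) (fun S => S :\ i)) /=; last first.
  by move=> S /andP[iS _]; rewrite setD1K.
apply: eq_bigl => S; rewrite setU11 /=.
have [iS|iS] := boolP (i \in S); last by rewrite setU1K // cardsU1 iS eqxx andbT.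
by apply/andP => -[_ /eqP E]; move: iS; rewrite -E setD11.
Qed.

Lemma sum_setI1 x i (a : nat) :
  \sum_(S : {set 'I_n.+1} | (i \in S) && (#|S| == a.+1)) \prod_(l in S) x l =
  x i * elem_sym_avoid x i a.
Proof.
rewrite sum_setU1 mulr_sumr; apply: eq_bigr => S /andP[iS _].
by rewrite big_setU1.
Qed.

Lemma elem_symS x i a :
  elem_sym x a.+1 = elem_sym_avoid x i a.+1 + x i * elem_sym_avoid x i a.
Proof.
rewrite /elem_sym (bigID (fun S : {set _} => i \in S)) /= addrC; congr (_ + _).
  by apply: eq_bigl => S; rewrite andbC.
by rewrite -sum_setI1; apply: eq_bigl => S; rewrite andbC.
Qed.

Lemma elem_sym0 x : elem_sym x 0 = 1.
Proof.
rewrite /elem_sym (big_pred1 set0) ?big_set0 // => S /=.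
by rewrite cards_eq0.
Qed.

Lemma elem_sym_avoid0 x i : elem_sym_avoid x i 0 = 1.
Proof.
rewrite /elem_sym_avoid (big_pred1 set0) ?big_set0 // => S /=.
by rewrite cards_eq0; case: eqP => [->|]; rewrite ?inE ?andbF.
Qed.

Lemma elem_sym_full x : elem_sym x n.+1 = \prod_l x l.
Proof.
rewrite /elem_sym (big_pred1 setT) /=; first by apply: eq_bigl => l; rewrite inE.
move=> S; rewrite -[RHS]/(S == setT) eqEcard subsetT cardsT card_ord /=.
by rewrite eqn_leq -[X in (_ <= X)%N && _](card_ord n.+1) max_card.
Qed.

Lemma elem_sym_gt x a :
  (n.+1 < a)%N -> elem_sym x a = 0.
Proof.
move=> lta; rewrite /elem_sym big_pred0 // => S; apply/negbTE.
by rewrite neq_ltn (leq_ltn_trans _ lta) // -[X in (_ <= X)%N]card_ord max_card.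
Qed.

(** Double counting: a set of size a+1 arises once from each of its elements i. *)
Lemma sum_elem_sym_avoid x a :
  \sum_i x i * elem_sym_avoid x i a = a.+1%:R * elem_sym x a.+1.
Proof.
under eq_bigr do rewrite -sum_setI1.
rewrite (exchange_big_dep (fun S : {set _} => #|S| == a.+1)) /=; last first.
  by move=> i S _ /andP[].
rewrite /elem_sym mulr_sumr; apply: eq_bigr => S cS.
under eq_bigl do rewrite cS andbT.
by rewrite sumr_const (eqP cS) mulr_natl.
Qed.

(** Induction on a for all b at once: each step trades the pair (a+1, b) for (a, b+1) and splits off
    one product of two elementary symmetric functions, the term r = 0. *)
Lemma sum_elem_sym_avoidM x (a b : nat) : (a <= b)%N ->
  \sum_i x i * (elem_sym_avoid x i a * elem_sym_avoid x i b) =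
  \sum_(0 <= r < a.+1)
    (b.+1 - a + 2 * r)%:R * (elem_sym x (b.+1 + r) * elem_sym x (a - r)).
Proof.
elim: a b => [|a IH] b leab.
  rewrite big_nat1 subn0 muln0 !addn0 elem_sym0 mulr1 -sum_elem_sym_avoid.
  by apply: eq_bigr => i _; rewrite elem_sym_avoid0 mul1r.
rewrite big_nat_recl // muln0 addn0 subn0 addn0.
(* Both b+1 and a+1 are absorbed by [sum_elem_sym_avoid]; expanding the remaining factors by
   [elem_symS], the terms x_i^2 E_a^i E_b^i cancel. *)
transitivity ((b.+1%:R - a.+1%:R) * (elem_sym x b.+1 * elem_sym x a.+1) +
  \sum_i x i * (elem_sym_avoid x i a * elem_sym_avoid x i b.+1)).
  rewrite mulrBl [X in X - _]mulrA -sum_elem_sym_avoid.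
  rewrite [elem_sym x b.+1 * _]mulrC mulrA -sum_elem_sym_avoid !mulr_suml.
  rewrite -sumrB -big_split /=; apply: eq_bigr => i _.
  by rewrite (elem_symS x i a) (elem_symS x i b); ring.
rewrite -natrB; last by rewrite leqW.
congr (_ + _); rewrite IH; last by rewrite leqW // ltnW.
apply: eq_bigr => r _; rewrite subSS addSnnS; congr (_%:R * _).
by move: leab; clear; lia.
Qed.

(** As the total product is 1, inverting the product over S gives the product over the complement of
    S. This complement contains i, whence the factor x_i, and its other n-a elements form the new
    index set. *)
Lemma elem_sym_avoidV x i a : (a <= n)%N -> (forall l, x l != 0) ->
  \prod_l x l = 1 ->
  elem_sym_avoid (fun l => (x l)^-1) i a = x i * elem_sym_avoid x i (n - a).
Proof.
move=> lean x0 x1; rewrite /elem_sym_avoid.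
rewrite (reindex_onto (fun S => ~: (i |: S)) (fun S => ~: (i |: S))) /=; last first.
  move=> S /andP[iS _]; apply/setP => l; rewrite !inE negb_or negbK.
  by case: eqP => [->|] //=; rewrite (negbTE iS).
rewrite mulr_sumr; apply: eq_big => S.
  rewrite setCU setIC -setDE setD11 /=.
  have [iS|iS] := boolP (i \in S).
    apply/andP => -[_ /eqP E]; move: iS.
    by rewrite -E !inE eqxx.
  have := max_card (mem (i |: S)); rewrite cardsU1 iS card_ord => cS.
  have -> : (~: (i |: (~: S :\ i)) = S).
    apply/setP => l; rewrite !inE negb_or negb_and !negbK.
    by case: eqP => [->|] //=; rewrite (negbTE iS).
  rewrite eqxx andbT setDE -setCU setUC cardsCs setCK cardsU1 iS card_ord.
  by move: #|S| cS lean => s /= cS lean; apply/eqP/eqP; clear -cS lean; lia.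
move=> /andP[/andP[_ _] /eqP E].
have iS : i \notin S by rewrite -E !inE eqxx.
rewrite -big_setU1 //= prodfV.
have nz : \prod_(l in ~: (i |: S)) x l != 0 by apply/prodf_neq0 => l _.
apply: (mulfI nz); rewrite divff //.
transitivity (\prod_l x l) => //; rewrite (bigID (mem (i |: S))) /= mulrC.
by congr (_ * _); apply: eq_bigl => l; rewrite !inE.
Qed.

Lemma card_draws_avoid i a :
  \sum_(S : {set 'I_n.+1} | (i \notin S) && (#|S| == a)) 1 = 'C(n, a)%:R :> F.
Proof.
have cD : #|[set~ i]| = n by rewrite cardsC1 card_ord.
rewrite -[in RHS]cD -cards_draws -sum1_card natr_sum; apply: eq_bigl => S.
rewrite inE; congr (_ && _); apply/idP/subsetP => [iS l lS|sub].
  by rewrite !inE; apply: contraNneq iS => <-.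
by apply/negP => /sub; rewrite !inE eqxx.
Qed.

End ElementarySymmetric.

(** * Polynomials in several variables are determined by their values *)

Section PolynomialFunctions.
Variable F : numFieldType.

Lemma poly_eq0_of_horner (p : {poly F}) (u : nat -> F) :
  injective u -> (forall k, p.[u k] = 0) -> p = 0.
Proof.
move=> uI pu; apply: (@roots_geq_poly_eq0 _ _ (map u (iota 0 (size p)))).
- by apply/allP => _ /mapP[k _ ->]; apply/eqP.
- by rewrite map_inj_uniq ?iota_uniq.
- by rewrite size_map size_iota.
Qed.

Lemma meval_muni n (P : {mpoly F[n.+1]}) (v : 'I_n.+1 -> F) :
  P.@[v] =
  (map_poly (meval (fun i => v (widen_ord (leqnSn n) i))) (muni P)).[v ord_max].
Proof.
rewrite mevalE muniE rmorph_sum horner_sum; apply: eq_bigr => m _.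
rewrite /= !map_polyZ map_polyXn /= mevalZ mevalX !hornerE.
rewrite big_ord_recr /= mulrA; congr (_ * _ * _).
by apply: eq_bigr => i _; rewrite mnmE.
Qed.

(** Each coefficient of P reappears in [muni P]: splitting a multi-exponent into its last entry and
    the others loses nothing. *)
Lemma muni_eq0 n (P : {mpoly F[n.+1]}) : muni P = 0 -> P = 0.
Proof.
move=> P0; apply/mpolyP => m; rewrite mcoeff0.
have := congr1 (fun q : {poly _} =>
  (q`_(m ord_max))@_[multinom m (widen_ord (leqnSn n) i) | i < n]) P0.
rewrite coef0 mcoeff0 muniE coef_sum raddf_sum /= => <-.
have E (m' : 'X_{1..n.+1}) :
    ((P@_m' *: 'X_[[multinom m' (widen_ord (leqnSn n) i) | i < n]]
       *: 'X^(m' ord_max))`_(m ord_max))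
      @_[multinom m (widen_ord (leqnSn n) i) | i < n] = P@_m' *+ (m' == m).
  rewrite coefZ coefXn mulr_natr mcoeffMn mcoeffZ mcoeffX.
  have [->|ne] := eqVneq m' m; first by rewrite !eqxx mulr1.
  case: eqP => [e1|]; last by rewrite mulr0 mul0rn.
  case: eqP => [e2|]; last by rewrite mulr0n.
  case/eqP: ne; apply/mnmP => i.
  have [j ->|->] := unliftP ord_max i; last by rewrite e2.
  have := congr1 (fun q : 'X_{1..n} => q j) e1; rewrite !mnmE.
  by congr (m' _ = m _); apply: val_inj; rewrite /= /bump leqNgt ltn_ord.
under eq_bigr do rewrite E.
have [mP|mP] := boolP (m \in msupp P).
  rewrite (bigD1_seq m) ?msupp_uniq //= eqxx big1 ?addr0 // => m' /negbTE ->.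
  by rewrite mulr0n.
rewrite (memN_msupp_eq0 mP) big1_seq // => m' /andP[_ m'P].
by case: eqP => // E'; rewrite -E' m'P in mP.
Qed.

(** Induction on the number of variables: with the first n values fixed, the polynomial in the last
    variable vanishes at all naturals, so each of its coefficients vanishes at every point and the
    induction hypothesis applies to it. *)
Lemma mpoly_eq0_of_meval n (P : {mpoly F[n]}) :
  (forall v, P.@[v] = 0) -> P = 0.
Proof.
elim: n P => [|n IH] P Pv.
  apply/mpolyP => m; rewrite mcoeff0.
  have := Pv (fun=> 0); rewrite mevalE => <-.
  have E0 (m' : 'X_{1..0}) : m' = m by apply/mnmP => -[].
  have [mP|mP] := boolP (m \in msupp P).
    rewrite (bigD1_seq m) ?msupp_uniq //= big_ord0 mulr1 big1 ?addr0 //.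
    by move=> m'; rewrite (E0 m') eqxx.
  rewrite (memN_msupp_eq0 mP) big1_seq // => m' /andP[_ m'P].
  by rewrite -(E0 m') m'P in mP.
apply: muni_eq0; apply/polyP => k; rewrite coef0; apply: IH => v.
rewrite -coef_map.
suff -> : map_poly (meval v) (muni P) = 0 by rewrite coef0.
apply: (@poly_eq0_of_horner _ (fun k : nat => k%:R)).
  by move=> a b /eqP; rewrite eqr_nat => /eqP.
move=> c; pose w (i : 'I_n.+1) := if unlift ord_max i is Some j then v j else c%:R.
have wl : w ord_max = c%:R by rewrite /w unlift_none.
have := Pv w; rewrite meval_muni wl => <-.
congr (_.[_]); apply: eq_map_poly => q; apply: meval_eq => i.
have -> : widen_ord (leqnSn n) i = lift ord_max i.
  by apply: val_inj; rewrite /= /bump leqNgt ltn_ord.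
by rewrite /w liftK.
Qed.

End PolynomialFunctions.

(** * Laurent polynomial functions and vanishing on tori *)

Section Laurent.
Variable C : numClosedFieldType.

(** Negative powers are cleared by z^N, so that root counting applies to an ordinary polynomial; the
    value of f at 0 is left free. *)
Definition laurent (f : C -> C) : Prop :=
  exists N (q : {poly C}), forall z : C, z != 0 -> z ^+ N * f z = q.[z].

Lemma eq_laurent f g : (forall z, z != 0 -> f z = g z) -> laurent f -> laurent g.
Proof.
by move=> fg [N [q Hq]]; exists N, q => z z0; rewrite -fg // Hq.
Qed.

Lemma laurent_cst c : laurent (fun=> c).
Proof. by exists 0%N, c%:P => z _; rewrite hornerC mul1r. Qed.

Lemma laurent_id : laurent id.
Proof. by exists 0%N, 'X => z _; rewrite hornerX mul1r. Qed.

Lemma laurent_inv : laurent GRing.inv.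
Proof. by exists 1%N, 1 => z z0; rewrite hornerC divff. Qed.

Lemma laurentD f g : laurent f -> laurent g -> laurent (fun z => f z + g z).
Proof.
move=> [N [p Hp]] [M [q Hq]]; exists (N + M)%N, ('X^M * p + 'X^N * q) => z z0.
by rewrite hornerD !hornerM !hornerXn -Hp // -Hq // exprD; ring.
Qed.

Lemma laurentM f g : laurent f -> laurent g -> laurent (fun z => f z * g z).
Proof.
move=> [N [p Hp]] [M [q Hq]]; exists (N + M)%N, (p * q) => z z0.
by rewrite hornerM -Hp // -Hq // exprD; ring.
Qed.

Lemma laurentX f k : laurent f -> laurent (fun z => f z ^+ k).
Proof.
move=> fL; elim: k => [|k IH]; first exact: laurent_cst.
by apply: eq_laurent (laurentM fL IH) => z _; rewrite exprS.
Qed.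

Lemma laurent_sum I (r : seq I) (P : pred I) (f : I -> C -> C) :
  (forall i, laurent (f i)) -> laurent (fun z => \sum_(i <- r | P i) f i z).
Proof.
move=> fL; elim: r => [|i r IH].
  by apply: eq_laurent (laurent_cst 0) => z _; rewrite big_nil.
have [Pi|Pi] := boolP (P i).
  by apply: eq_laurent (laurentD (fL i) IH) => z _; rewrite big_cons Pi.
by apply: eq_laurent IH => z _; rewrite big_cons (negbTE Pi).
Qed.

Lemma laurent_prod I (r : seq I) (P : pred I) (f : I -> C -> C) :
  (forall i, laurent (f i)) -> laurent (fun z => \prod_(i <- r | P i) f i z).
Proof.
move=> fL; elim: r => [|i r IH].
  by apply: eq_laurent (laurent_cst 1) => z _; rewrite big_nil.
have [Pi|Pi] := boolP (P i).
  by apply: eq_laurent (laurentM (fL i) IH) => z _; rewrite big_cons Pi.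
by apply: eq_laurent IH => z _; rewrite big_cons (negbTE Pi).
Qed.

(* The Cayley transform of the naturals gives infinitely many points of the
   unit circle. *)
Lemma laurent_eq0 f : laurent f -> (forall z, `|z| = 1 -> f z = 0) ->
  forall z, z != 0 -> f z = 0.
Proof.
move=> [N [q Hq]] f0.
pose u (k : nat) : C := (k%:R + 'i) / (k%:R - 'i).
have cE (k : nat) : (k%:R + 'i)^* = k%:R - 'i :> C.
  by rewrite rmorphD /= conjCi rmorph_nat.
have pn (k : nat) : k%:R + 'i != 0 :> C.
  apply/eqP => /(congr1 (fun z : C => 'Im z)); rewrite raddfD /= Im_i raddf0.
  by rewrite (Creal_ImP _ _) ?realn // add0r; apply/eqP; rewrite oner_eq0.
have mn (k : nat) : k%:R - 'i != 0 :> C by rewrite -cE conjC_eq0.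
have u1 k : `|u k| = 1.
  by rewrite normrM normfV -cE norm_conjC divff // normr_eq0.
have q0 : q = 0.
  apply: (@poly_eq0_of_horner _ _ u) => [a b /eqP|k]; last first.
    have uk0 : u k != 0 by rewrite -normr_eq0 u1 oner_eq0.
    by rewrite -Hq // f0 // mulr0.
  rewrite eqr_div // -subr_eq0.
  have -> : (a%:R + 'i) * (b%:R - 'i) - (b%:R + 'i) * (a%:R - 'i) =
            2%:R * 'i * (b%:R - a%:R) :> C by ring.
  rewrite !mulf_eq0 pnatr_eq0 (negbTE (neq0Ci _)) /= subr_eq0 eqr_nat.
  by move/eqP.
move=> z z0; apply/eqP; have := Hq z z0; rewrite q0 horner0 => /eqP.
by rewrite mulf_eq0 expf_eq0 (negbTE z0) andbF.
Qed.

Definition upd n (y : 'I_n -> C) (k : 'I_n) (z : C) : 'I_n -> C :=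
  fun j => if j == k then z else y j.

(** The coordinates are released from the unit circle one at a time, each by [laurent_eq0]. *)
Lemma torus_eq0 n (G : ('I_n -> C) -> C) :
  (forall y y', y =1 y' -> G y = G y') ->
  (forall y k, (forall j, y j != 0) -> laurent (fun z => G (upd y k z))) ->
  (forall y, (forall j, `|y j| = 1) -> G y = 0) ->
  forall y, (forall j, y j != 0) -> G y = 0.
Proof.
move=> Gext GL G1.
(* The first k coordinates are already free; the others still lie on the unit circle. *)
suff H k : (k <= n)%N -> forall y, (forall j, y j != 0) ->
    (forall j : 'I_n, (k <= j)%N -> `|y j| = 1) -> G y = 0.
  by move=> y y0; apply: (H n) => // j; rewrite leqNgt ltn_ord.
elim: k => [_ y y0 y1|k IH ltkn y y0 y1]; first by apply: G1 => j; apply: y1.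
pose K := Ordinal ltkn.
(* [G] is now viewed as a function of coordinate [K] alone. The two arguments agree only pointwise,
   hence the use of [Gext]. *)
rewrite (Gext y (upd y K (y K))); last first.
  by move=> j; rewrite /upd; case: eqP => [->|].
apply: (laurent_eq0 (GL y K y0)) => // z z1.
apply: IH => [|j|j lekj]; first exact: ltnW.
  by rewrite /upd; case: (j =P K) => // _; rewrite -normr_eq0 z1 oner_eq0.
rewrite /upd; case: (j =P K) => // /eqP ne; apply: y1.
by rewrite ltn_neqAle lekj andbT eq_sym.
Qed.

End Laurent.

(** * Zariski density of the image of the compact torus *)

Section Density.
Variables (C : numClosedFieldType) (n : nat).

Lemma meval_elem_sym (x : 'I_n.+1 -> C) a :
  (mesym n.+1 C a).@[x] = elem_sym x a.
Proof.
rewrite /mesym raddf_sum /=; apply: eq_bigr => S _; rewrite rmorph_prod /=.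
by apply: eq_bigr => l _; rewrite mevalXU.
Qed.

(** By Vieta, x is the family of roots of a monic polynomial whose coefficients are the prescribed
    values up to sign. *)
Lemma elem_sym_surj (c : 'I_n -> C) :
  exists x : 'I_n.+1 -> C,
    \prod_l x l = 1 /\ forall l : 'I_n, elem_sym x l.+1 = c l.
Proof.
(* Extended by 1 at both ends: c' 0 makes the polynomial monic, and c' (n+1) makes the product of
   the roots 1. *)
pose c' (a : nat) : C :=
  if a is l.+1 then if insub l is Some o then c o else 1 else 1.
pose p := \poly_(i < n.+2) ((-1) ^+ (n.+1 - i) * c' (n.+1 - i)%N).
have lp : p`_n.+1 = 1 by rewrite coef_poly ltnSn subnn mul1r.
have sp : size p = n.+2.
  by apply: size_poly_eq; rewrite subnn mul1r oner_neq0.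
have [r Dp] := closed_field_poly_normal p.
rewrite lead_coefE sp lp scale1r in Dp.
have sr : size r == n.+1.
  by have := sp; rewrite Dp size_prod_XsubC => -[->].
pose t := Tuple sr.
have ec (a : nat) : (a < n.+2)%N -> elem_sym (tnth t) a = c' a.
  move=> lta; have := mroots_coeff t (Ordinal lta).
  rewrite (_ : \prod_(c <- t) _ = p) ?[RHS]Dp //.
  rewrite coef_poly ltnS leq_subr meval_elem_sym /= subKn //.
  by move/(can_inj (signrMK _)) => <-.
exists (tnth t); split=> [|l].
  by rewrite -elem_sym_full ec // /c' insubF // ltnn.
rewrite ec; last by rewrite !ltnS ltnW.
by rewrite /c' insubT //= => ltl; congr c; apply: val_inj.
Qed.

(** Vanishing spreads from the compact torus to the complex one, which maps onto C^n by
    [elem_sym_surj]. The factors [d] leave room for the binomial normalisation of the zonal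
    functions. *)
Lemma elem_sym_dense (d : 'I_n -> C) (P : {mpoly C[n]}) :
  (forall l, d l != 0) ->
  (forall x : 'I_n.+1 -> C, (forall i, `|x i| = 1) -> \prod_l x l = 1 ->
     P.@[fun l => d l * elem_sym x l.+1] = 0) ->
  P = 0.
Proof.
move=> d0 P1.
(* The first n coordinates parametrise the torus where the product is 1. *)
pose ext (y : 'I_n -> C) (i : 'I_n.+1) : C :=
  if unlift ord_max i is Some j then y j else (\prod_j y j)^-1.
have ext_prod y : (forall j, y j != 0) -> \prod_l ext y l = 1.
  move=> y0; rewrite big_ord_recr /= /ext unlift_none.
  rewrite (eq_bigr y) ?divff //; first by apply/prodf_neq0.
  move=> j _; have -> : widen_ord (leqnSn n) j = lift ord_max j.
    by apply: val_inj; rewrite /= /bump leqNgt ltn_ord.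
  by rewrite liftK.
have Plaurent (v : 'I_n -> C -> C) : (forall i, laurent (v i)) ->
    laurent (fun z => P.@[fun i => v i z]).
  move=> vL; apply: (@eq_laurent _ (fun z => \sum_(m <- msupp P)
    (P@_m * \prod_i v i z ^+ m i))) => [z _|]; first by rewrite mevalE.
  apply: laurent_sum => m; apply: laurentM; first exact: laurent_cst.
  by apply: laurent_prod => i; apply: laurentX.
have vanish := @torus_eq0 C n (fun y => P.@[fun l => d l * elem_sym (ext y) l.+1]).
apply: mpoly_eq0_of_meval => c.
have [x [x1 xc]] := elem_sym_surj (fun l => (d l)^-1 * c l).
have x0 i : x i != 0.
  have : \prod_l x l != 0 by rewrite x1 oner_neq0.
  by move/prodf_neq0; apply.
pose y j := x (lift ord_max j).
have y0 j : y j != 0 := x0 _.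
have yp : \prod_j y j != 0 by apply/prodf_neq0.
have extE : ext y =1 x.
  move=> i; rewrite /ext; case: unliftP => [j ->|->] //.
  apply: (mulfI yp); rewrite divff //.
  transitivity (\prod_l x l) => //.
  rewrite big_ord_recr /=; congr (_ * _); apply: eq_bigr => j _.
  by congr x; apply: val_inj; rewrite /= /bump leqNgt ltn_ord.
have eq_elem_sym a (z z' : 'I_n.+1 -> C) : z =1 z' -> elem_sym z a = elem_sym z' a.
  by move=> zz'; apply: eq_bigr => S _; apply: eq_bigr.
have -> : P.@[c] = P.@[fun l => d l * elem_sym (ext y) l.+1].
  by apply: meval_eq => l; rewrite (eq_elem_sym _ _ _ extE) xc mulVKf.
apply: vanish => // {c x x1 xc x0 y y0 yp extE} [y y' yy'|y k y0|y y1].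
- apply: meval_eq => l; congr (_ * _); apply: eq_elem_sym => i; rewrite /ext.
  by case: unliftP => // _; congr _^-1; apply: eq_bigr.
- apply: Plaurent => l; apply: laurentM; first exact: laurent_cst.
  apply: laurent_sum => S; apply: laurent_prod => i; rewrite /ext.
  case: unliftP => [j _|_].
    by rewrite /upd; case: eqP => _; [exact: laurent_id|exact: laurent_cst].
  (* The dependent last coordinate is a constant times z^-1: this is where Laurent polynomials, not
     just polynomials, are needed. *)
  apply: (@eq_laurent _ (fun z => (\prod_(j | j != k) y j)^-1 * z^-1)).
    move=> z _; rewrite [in RHS](bigD1 k) //= invfM mulrC /upd eqxx.
    by congr (_ * _^-1); apply: eq_bigr => j /negbTE ->.
  by apply: laurentM; [exact: laurent_cst|exact: laurent_inv].
apply: P1; last by apply: ext_prod => j; rewrite -normr_eq0 y1 oner_eq0.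
move=> i; rewrite /ext; case: unliftP => // _.
by rewrite normfV normr_prod big1 ?invr1.
Qed.

End Density.

(** * Monomial matrices acting on exterior powers *)

Lemma imset_perm1 (T : finType) (S : {set T}) : (1%g : {perm T}) @: S = S.
Proof. by rewrite (eq_imset _ (@perm1 T)) imset_id. Qed.

Section ExteriorPowers.
Variables (R : realType) (n : nat).
Local Notation C := (R[i]).

(** With the convention e_b |-> d_b e_(s b), one family covers both the diagonal torus (s = 1) and
    the signed transpositions. *)
Definition monomial_mx (s : 'S_n.+1) (d : 'I_n.+1 -> C) : 'M[C]_n.+1 :=
  \matrix_(a, b) (d b *+ (a == s b)).

Lemma det_monomial_mx s d : \det (monomial_mx s d) = (-1) ^+ s * \prod_l d l.
Proof.
have -> : monomial_mx s d = (perm_mx s)^T *m diag_mx (\row_l d l).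
  by apply/matrixP => a b; rewrite mul_mx_diag !mxE mulr_natl eq_sym.
rewrite det_mulmx det_tr det_perm det_diag.
by congr (_ * _); apply: eq_bigr => l _; rewrite mxE.
Qed.

Lemma card_ext_index m (p : 'I_(ext_dim n m)) : #|enum_val p| = m.
Proof. by have := enum_valP p; rewrite inE => /eqP. Qed.

Lemma ext_index_in m (p : 'I_(ext_dim n m)) (i : 'I_m) :
  ext_index p i \in enum_val p.
Proof.
by rewrite /ext_index -mem_enum mem_nth // -cardE card_ext_index.
Qed.

Lemma ext_index_inj m (p : 'I_(ext_dim n m)) : injective (ext_index p).
Proof.
move=> i j /eqP; rewrite /ext_index nth_uniq ?enum_uniq ?inE -?cardE ?card_ext_index //.
by move/eqP/val_inj.
Qed.

Lemma ext_index_surj m (p : 'I_(ext_dim n m)) l :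
  l \in enum_val p -> exists i, ext_index p i = l.
Proof.
rewrite -mem_enum => lp; have := lp; rewrite -index_mem -cardE card_ext_index.
by move=> ltm; exists (Ordinal ltm); rewrite /ext_index /= nth_index.
Qed.

Lemma prod_ext_index m (p : 'I_(ext_dim n m)) (d : 'I_n.+1 -> C) :
  \prod_i d (ext_index p i) = \prod_(l in enum_val p) d l.
Proof.
by rewrite -[RHS]big_enum (big_nth ord0) -cardE card_ext_index big_mkord.
Qed.

(** An index of p outside the image of q gives a zero row of the minor. *)
Lemma ext_pow_monomial_eq0 m (s : 'S_n.+1) d (p q : 'I_(ext_dim n m)) :
  enum_val p != s @: enum_val q -> ext_pow m (monomial_mx s d) p q = 0.
Proof.
rewrite eqEcard card_imset ?card_ext_index ?leqnn ?andbT; last exact: perm_inj.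
case/subsetPn => l lp lq; have [i il] := ext_index_surj lp.
rewrite !mxE (expand_det_row _ i) big1 // => j _; rewrite !mxE il.
case: eqP => [E|_]; last by rewrite mulr0n mul0r.
by rewrite E imset_f ?ext_index_in in lq.
Qed.

(** The submatrix is again monomial with entries of modulus 1, hence unitary; the sign of its
    determinant need not be computed. *)
Lemma norm_ext_pow_monomial m (s : 'S_n.+1) d (p q : 'I_(ext_dim n m)) :
  (forall l, `|d l| = 1) -> enum_val p = s @: enum_val q ->
  `|ext_pow m (monomial_mx s d) p q| = 1.
Proof.
move=> d1 pq; rewrite !mxE; set M := rowsub _ _.
suff MM : M ^t* *m M = 1%:M.
  have := congr1 determinant MM; rewrite det1 det_mulmx det_map_mx det_tr => E.
  by apply/eqP; rewrite -sqrp_eq1 ?normr_ge0 // normCK mulrC E.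
apply/matrixP => j k; rewrite !mxE.
have [i ij] : exists i, ext_index p i = s (ext_index q j).
  by apply: ext_index_surj; rewrite pq imset_f ?ext_index_in.
rewrite (bigD1 i) //= big1 ?addr0 => [|l li]; last first.
  rewrite !mxE -ij (inj_eq (@ext_index_inj _ p)) (negbTE li) mulr0n.
  by rewrite rmorph0 mul0r.
rewrite !mxE ij eqxx mulr1n (inj_eq (@perm_inj _ s)).
rewrite (inj_eq (@ext_index_inj _ q)); case: eqP => [<-|_].
  by rewrite mulr1n mulrC -normCK d1 expr1n.
by rewrite mulr0n mulr0.
Qed.

Lemma ext_pow_monomial1 m d (p : 'I_(ext_dim n m)) :
  ext_pow m (monomial_mx 1 d) p p = \prod_(l in enum_val p) d l.
Proof.
rewrite !mxE -prod_ext_index.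
have -> : rowsub (@ext_index n m p) (colsub (@ext_index n m p) (monomial_mx 1 d))
    = diag_mx (\row_i d (ext_index p i)).
  apply/matrixP => i j; rewrite !mxE perm1 (inj_eq (@ext_index_inj _ p)).
  by case: eqP => [->|].
by rewrite det_diag; apply: eq_bigr => i _; rewrite mxE.
Qed.

(** Only one basis vector is sent to a multiple of the given one. Independent [d] and [e] serve both
    the elements (h, h) of H and the elements (t, t^-1) of A. *)
Lemma V_act_monomialE m (s : 'S_n.+1) d e N (J : 'M[C]_(V_dim n m, N)) i
    (p1 q1 : 'I_(ext_dim n m)) (p2 q2 : 'I_(ext_dim n (n + 2 - m))) :
  enum_val p1 = s @: enum_val q1 -> enum_val p2 = s @: enum_val q2 ->
  (V_act m (monomial_mx s d, monomial_mx s e) *m J) (mxtens_index (p1, p2)) i =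
  ext_pow m (monomial_mx s d) p1 q1
    * ext_pow (n + 2 - m) (monomial_mx s e) p2 q2
    * J (mxtens_index (q1, q2)) i.
Proof.
move=> pq1 pq2; rewrite mxE (bigD1 (mxtens_index (q1, q2))) //= big1 ?addr0.
  by rewrite tensmxE.
move=> Q; case: (mxtens_indexP Q) => r1 r2 ne; rewrite tensmxE.
have [E1|E1] := eqVneq r1 q1; last first.
  rewrite ext_pow_monomial_eq0 ?mul0r // pq1.
  by rewrite (inj_eq (imset_inj (@perm_inj _ s))) (inj_eq enum_val_inj) eq_sym.
have [E2|E2] := eqVneq r2 q2; first by rewrite E1 E2 eqxx in ne.
rewrite [X in _ * X * _]ext_pow_monomial_eq0 ?mulr0 ?mul0r // pq2.
by rewrite (inj_eq (imset_inj (@perm_inj _ s))) (inj_eq enum_val_inj) eq_sym.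
Qed.

End ExteriorPowers.

(** * Coordinates of an isometric equivariant embedding *)

Section Embedding.
Variables (R : realType) (n m : nat).
Local Notation C := (R[i]).
Variables (J : 'M[C]_(V_dim n m, n.+1)).
Hypotheses (hJ : isometric_H_embedding J) (hm : (m <= n + 2)%N).

Lemma embedding_monomial (s : 'S_n.+1) d i
    (p1 q1 : 'I_(ext_dim n m)) (p2 q2 : 'I_(ext_dim n (n + 2 - m))) :
  \det (monomial_mx s d) = 1 ->
  enum_val p1 = s @: enum_val q1 -> enum_val p2 = s @: enum_val q2 ->
  ext_pow m (monomial_mx s d) p1 q1
    * ext_pow (n + 2 - m) (monomial_mx s d) p2 q2
    * J (mxtens_index (q1, q2)) i =
  J (mxtens_index (p1, p2)) (s i) * d i.
Proof.
move=> det1 pq1 pq2; rewrite -V_act_monomialE // hJ.2 // mxE.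
rewrite (bigD1 (s i)) //= big1 ?addr0 => [|b bi].
  by rewrite !mxE eqxx mulr1n.
by rewrite !mxE (negbTE bi) mulr0n mulr0.
Qed.

(** The two sets cover i twice and every other index once: on the diagonal torus of determinant 1,
    such a basis vector has the weight of e_i. *)
Definition supported i (p1 : 'I_(ext_dim n m)) (p2 : 'I_(ext_dim n (n + 2 - m))) :=
  (i \in enum_val p1) && (enum_val p2 == ~: (enum_val p1 :\ i)).

(** Write S, T for the two sets. Torus equivariance makes the multiplicity of a in S and T, minus
    the indicator of a = i, independent of a; the sizes m and n+2-m then force this constant to be
    1. *)
Lemma embedding_support i p1 p2 :
  J (mxtens_index (p1, p2)) i != 0 -> supported i p1 p2.
Proof.
move=> J0.
have weight a b : ((a \in enum_val p1) + (a \in enum_val p2) + (i == b) =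
    (b \in enum_val p1) + (b \in enum_val p2) + (i == a))%N.
  have [->//|ab] := eqVneq a b.
  (* The test element has 2 at a, 1/2 at b and 1 elsewhere; the identity [weight] compares exponents
     of 2. *)
  pose d (l : 'I_n.+1) : C := 2%:R ^+ (l == a) * (2%:R^-1) ^+ (l == b).
  have dprod (S : {set 'I_n.+1}) :
      \prod_(l in S) d l = 2%:R ^+ (a \in S) * (2%:R^-1) ^+ (b \in S).
    have cnt c : (\sum_(l in S) (l == c) = (c \in S))%N.
      have [cS|cS] := boolP (c \in S).
        by rewrite (bigD1 c) //= eqxx big1 // => l /andP[_ /negbTE ->].
      rewrite big1 // => l lS; case: eqP => // E.
      by rewrite -E lS in cS.
    by rewrite big_split /= !prodrXr !cnt.
  have det1 : \det (monomial_mx 1 d) = 1.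
    rewrite det_monomial_mx odd_perm1 mul1r.
    have -> : \prod_l d l = \prod_(l in [set: 'I_n.+1]) d l.
      by apply: eq_bigl => l; rewrite inE.
    by rewrite dprod !inE !expr1 divff // pnatr_eq0.
  have := @embedding_monomial 1 d i p1 p1 p2 p2 det1.
  rewrite !ext_pow_monomial1 !dprod perm1.
  move/(_ (esym (imset_perm1 _)) (esym (imset_perm1 _))).
  rewrite [RHS]mulrC => /(mulIf J0) /eqP.
  rewrite /d mulrACA -!exprD !exprVn eqr_div ?expf_neq0 ?pnatr_eq0 //.
  by rewrite -!exprD -!natrX eqr_nat eqn_exp2l // => /eqP E; lia.
have sumS (S : {set 'I_n.+1}) : (\sum_b (b \in S) = #|S|)%N.
  by rewrite -sum1_card [RHS]big_mkcond /=; apply: eq_bigr => b _; case: ifP.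
(* Summing [weight] over b turns the multiplicities of b into the total size n+2. *)
have count a : ((a \in enum_val p1) + (a \in enum_val p2) = 1 + (i == a))%N.
  have : (\sum_b ((a \in enum_val p1) + (a \in enum_val p2) + (i == b)) =
      \sum_b ((b \in enum_val p1) + (b \in enum_val p2) + (i == a)))%N.
    by apply: eq_bigr => b _; apply: weight.
  rewrite !big_split /= !sum_nat_const card_ord !sumS !card_ext_index.
  have -> : (\sum_b (i == b) = 1)%N.
    by rewrite (bigD1 i) //= eqxx big1 // => b; rewrite eq_sym => /negbTE ->.
  by move=> E; apply/eqP; rewrite -(eqn_pmul2l (ltn0Sn n)); lia.
apply/andP; split.
  by have := count i; rewrite eqxx; case: (i \in _); case: (i \in _).
apply/eqP/setP => a; have := count a; rewrite !inE eq_sym negb_and negbK.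
by case: (a == i); case: (a \in _); case: (a \in _).
Qed.

Lemma supported_imset i (s : 'S_n.+1) p1 p2 q1 q2 :
  s i = i -> supported i q1 q2 -> enum_val p1 = s @: enum_val q1 ->
  supported i p1 p2 -> enum_val p2 = s @: enum_val q2.
Proof.
move=> si /andP[_ /eqP q12] pq1 /andP[_ /eqP ->].
rewrite q12 pq1; apply/setP => l; rewrite !inE.
have [k ->] : exists k, l = s k by exists (s^-1%g l); rewrite permKV.
rewrite !(mem_imset _ _ (@perm_inj _ s)) !inE.
by rewrite -{1}si (inj_eq (@perm_inj _ s)).
Qed.

Lemma supported_exists i (p1 : 'I_(ext_dim n m)) :
  i \in enum_val p1 -> exists p2, supported i p1 p2.
Proof.
move=> ip; have c : ~: (enum_val p1 :\ i) \in ext_basis n (n + 2 - m).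
  have := cardsD1 i (enum_val p1); rewrite ip card_ext_index => mE.
  rewrite inE cardsCs setCK card_ord; apply/eqP; lia.
exists (enum_rank_in c (~: (enum_val p1 :\ i))).
by rewrite /supported ip enum_rankK_in ?eqxx.
Qed.

(** Induction on the size of p1 minus q1: a signed transposition fixing i exchanges an element a of
    p1 outside q1 with an element b of q1 outside p1, and equivariance under it preserves the
    modulus of the coordinate. *)
Lemma embedding_norm_const i p1 p2 q1 q2 :
  supported i p1 p2 -> supported i q1 q2 ->
  `|J (mxtens_index (p1, p2)) i| = `|J (mxtens_index (q1, q2)) i|.
Proof.
have [k] := ubnP #|enum_val p1 :\: enum_val q1|.
elim: k p1 p2 => // k IH p1 p2 ltk sp sq.
have [/eqP|] := posnP #|enum_val p1 :\: enum_val q1|.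
  rewrite cards_eq0 setD_eq0 => sub.
  have E : enum_val p1 = enum_val q1.
    by apply/eqP; rewrite eqEcard sub !card_ext_index leqnn.
  have E2 : enum_val p2 = enum_val q2.
    by case/andP: sp sq => _ /eqP -> /andP[_ /eqP ->]; rewrite E.
  by rewrite (enum_val_inj E) (enum_val_inj E2).
have := cardsID (enum_val q1) (enum_val p1).
have := cardsID (enum_val p1) (enum_val q1).
rewrite setIC !card_ext_index => cq cp.
move=> pos; have : (0 < #|enum_val q1 :\: enum_val p1|)%N by lia.
case/card_gt0P: (pos) => a; rewrite inE => /andP[aq ap].
case/card_gt0P => b; rewrite inE => /andP[bp bq].
have [ip iq] : i \in enum_val p1 /\ i \in enum_val q1.
  by case/andP: sp; case/andP: sq.
have ia : a != i by apply: contraNneq aq => ->.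
have ib : b != i by apply: contraNneq bp => ->.
have ab : a != b by apply: contraNneq bp => <-.
pose s := tperm a b.
have si : s i = i by rewrite tpermD.
(* The sign at a compensates the determinant -1 of the transposition. *)
pose d (l : 'I_n.+1) : C := if l == a then -1 else 1.
have d1 l : `|d l| = 1 by rewrite /d; case: ifP => _; rewrite ?normrN normr1.
have det1 : \det (monomial_mx s d) = 1.
  rewrite det_monomial_mx odd_tperm ab (bigD1 a) //= big1 => [|l la].
    by rewrite /d eqxx mulr1 expr1 mulrNN mulr1.
  by rewrite /d (negbTE la).
have c1 : s @: enum_val p1 \in ext_basis n m.
  by rewrite inE card_imset ?card_ext_index //; apply: perm_inj.
pose r1 := enum_rank_in c1 (s @: enum_val p1) : 'I_(ext_dim n m).
have r1E : enum_val r1 = s @: enum_val p1 by rewrite enum_rankK_in.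
have ir : i \in enum_val r1 by rewrite r1E -{1}si imset_f.
have [r2 sr] := supported_exists ir.
have r2E := supported_imset si sp r1E sr.
have := embedding_monomial i det1 r1E r2E; rewrite si => /(congr1 Num.norm).
rewrite !normrM !norm_ext_pow_monomial // d1 !mul1r mulr1 => ->.
(* The new difference with q1 lies in the old one with a removed. *)
apply: IH => //; rewrite ltnS in ltk; apply: leq_trans ltk; rewrite r1E.
rewrite [X in (_ < X)%N](cardsD1 a) inE aq ap ltnS.
apply: subset_leq_card; apply/subsetP => l; rewrite !inE => /andP[lq].
case/imsetP => k' kp lE; move: lq; rewrite lE /s.
case: tpermP => [_|kb|/eqP na _] lq; first by rewrite bq in lq.
  by rewrite kb (negbTE bp) in kp.
by rewrite na lq kp.
Qed.
Lemma sum_supported i (G : {set 'I_n.+1} -> {set 'I_n.+1} -> C) :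
  \sum_p1 \sum_(p2 | supported i p1 p2) G (enum_val p1) (enum_val p2) =
  \sum_(S : {set 'I_n.+1} | (i \in S) && (#|S| == m)) G S (~: (S :\ i)).
Proof.
transitivity (\sum_(p1 < ext_dim n m | i \in enum_val p1)
    G (enum_val p1) (~: (enum_val p1 :\ i))).
  rewrite [RHS]big_mkcond; apply: eq_bigr => p1 _.
  case: ifPn => [ip|ip]; last by rewrite big1 // => p2; rewrite /supported (negbTE ip).
  have [p2 sp] := supported_exists ip.
  have [_ /eqP E2] := andP sp.
  rewrite (big_pred1 p2) ?E2 // => p2'.
  by rewrite /supported ip -E2 (inj_eq enum_val_inj).
rewrite -(big_enum_val_cond (fun S : {set 'I_n.+1} => i \in S)
  (fun S => G S (~: (S :\ i)))) /=.
by apply: eq_bigl => S; rewrite inE andbC.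
Qed.

Lemma sum_mxtens_index (a b : nat) (G : 'I_(a * b) -> C) :
  \sum_P G P = \sum_p1 \sum_p2 G (mxtens_index (p1, p2)).
Proof.
rewrite pair_big /= (reindex (@mxtens_index a b)) /=; first by apply: eq_bigr => -[].
by exists (@mxtens_unindex a b) => P _; rewrite (mxtens_indexK, mxtens_unindexK).
Qed.

Lemma embedding_normE i : exists c : C, forall p1 p2,
  `|J (mxtens_index (p1, p2)) i| ^+ 2 = if supported i p1 p2 then c else 0.
Proof.
have [/= [q1 q2] /= sq|none] := pickP (fun q => supported i q.1 q.2).
  exists (`|J (mxtens_index (q1, q2)) i| ^+ 2) => p1 p2.
  case: ifPn => [sp|]; first by rewrite (embedding_norm_const sp sq).
  by apply: contraNeq; rewrite expf_eq0 normr_eq0 /=; apply: embedding_support.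
exists 0 => p1 p2; rewrite if_same; apply: contraFeq (none (p1, p2)).
by rewrite expf_eq0 normr_eq0 /=; apply: embedding_support.
Qed.

(** By [embedding_normE] the squared moduli of column i are a constant c on the support, so the
    diagonal entry is the plain average of the eigenvalues over the supported basis vectors. *)
Lemma embedding_diag_entry i (d : 'I_n.+1 -> C) (e : 'I_n.+1 -> C) :
  (\sum_(S : {set 'I_n.+1} | (i \in S) && (#|S| == m)) 1) *
    (J ^t* *m V_act m (monomial_mx 1 d, monomial_mx 1 e) *m J) i i =
  \sum_(S : {set 'I_n.+1} | (i \in S) && (#|S| == m))
    (\prod_(l in S) d l * \prod_(l in ~: (S :\ i)) e l).
Proof.
have [c cE] := embedding_normE i.
have sumE (G : {set 'I_n.+1} -> {set 'I_n.+1} -> C) :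
    \sum_p1 \sum_p2 `|J (mxtens_index (p1, p2)) i| ^+ 2 *
      G (enum_val p1) (enum_val p2) =
    c * \sum_(S : {set 'I_n.+1} | (i \in S) && (#|S| == m)) G S (~: (S :\ i)).
  rewrite -sum_supported mulr_sumr; apply: eq_bigr => p1 _.
  rewrite mulr_sumr [RHS]big_mkcond; apply: eq_bigr => p2 _.
  by rewrite cE; case: ifP; rewrite ?mul0r.
have -> : (J ^t* *m V_act m (monomial_mx 1 d, monomial_mx 1 e) *m J) i i =
    \sum_p1 \sum_p2 `|J (mxtens_index (p1, p2)) i| ^+ 2 *
      (\prod_(l in enum_val p1) d l * \prod_(l in enum_val p2) e l).
  rewrite -mulmxA mxE sum_mxtens_index; apply: eq_bigr => p1 _.
  apply: eq_bigr => p2 _.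
  rewrite (V_act_monomialE _ _ _ _ (esym (imset_perm1 _)) (esym (imset_perm1 _))).
  by rewrite !ext_pow_monomial1 !mxE normCK; ring.
rewrite (sumE (fun S T => \prod_(l in S) d l * \prod_(l in T) e l)) mulrCA mulrA.
(* The isometry condition says that column i of J has norm 1, which fixes c. *)
suff -> : c * \sum_(S : {set 'I_n.+1} | (i \in S) && (#|S| == m)) 1 = 1.
  by rewrite mul1r.
rewrite -(sumE (fun _ _ => 1)).
transitivity ((J ^t* *m J) i i); last by rewrite hJ.1 mxE eqxx.
rewrite mxE sum_mxtens_index; apply: eq_bigr => p1 _; apply: eq_bigr => p2 _.
by rewrite !mxE normCK mulr1 mulrC.
Qed.

End Embedding.

(** * The matrix of spherical functions and its Gram matrix on the compact torus *)

Section SphericalFunctions.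
Variables (R : realType) (n : nat).
Local Notation C := (R[i]).
Variable J : forall m : 'I_n.+1, 'M[C]_(V_dim n m.+1, n.+1).
Hypothesis hJ : forall m : 'I_n.+1, isometric_H_embedding (J m).

Lemma invmx_monomial1 (d : 'I_n.+1 -> C) : (forall l, d l != 0) ->
  invmx (monomial_mx 1 d) = monomial_mx 1 (fun l => (d l)^-1).
Proof.
move=> d0; have E : monomial_mx 1 d *m monomial_mx 1 (fun l => (d l)^-1) = 1%:M.
  apply/matrixP => a b; rewrite mxE (bigD1 a) //= big1 => [|l la].
    rewrite !mxE !perm1 eqxx mulr1n addr0; case: eqP => [->|_].
      by rewrite mulr1n divff.
    by rewrite mulr0n mulr0.
  by rewrite !mxE !perm1 eq_sym (negbTE la) mulr0n mul0r.
have [U _] := mulmx1_unit E.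
by rewrite -[RHS](mulKmx U) E mulmx1.
Qed.

(** For a supported pair with first set i |: S, the second set is the complement of S. Since det t =
    1, the inverse of t over that complement equals t over S, which gives t_i times the squares over
    S. *)
Lemma Phi0_entry (t : 'I_n.+1 -> C) i (m : 'I_n.+1) :
  (forall l, t l != 0) -> \prod_l t l = 1 ->
  'C(n, m)%:R * Phi0 J (monomial_mx 1 t, invmx (monomial_mx 1 t)) i m =
  t i * elem_sym_avoid (fun l => t l ^+ 2) i m.
Proof.
move=> t0 t1; rewrite invmx_monomial1 // mxE.
have hm : (m.+1 <= n + 2)%N by have := ltn_ord m; lia.
have := embedding_diag_entry (hJ m) hm i t (fun l => (t l)^-1).
rewrite !sum_setU1 card_draws_avoid => ->.
rewrite mulr_sumr; apply: eq_bigr => S /andP[iS _].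
rewrite setU1K // big_setU1 //= -mulrA prodrXl expr2; congr (_ * (_ * _)).
have nz : \prod_(l in ~: S) t l != 0 by apply/prodf_neq0.
apply: (mulIf nz); rewrite prodfV mulVf //.
transitivity (\prod_l t l) => //; rewrite (bigID (mem S)) /=.
by congr (_ * _); apply: eq_bigl => l; rewrite !inE.
Qed.

(** Indices start from 0 here. Conjugation turns E_(n-j)^i into x_i E_j^i, so row n-j yields the sum
    of the x_i E_j^i E_k^i. *)
Lemma Gram_Phi0_entry (t : 'I_n.+1 -> C) (j k : nat) :
  (forall l, `|t l| = 1) -> \prod_l t l = 1 -> (j <= k)%N -> (k <= n)%N ->
  let F := Phi0 J (monomial_mx 1 t, invmx (monomial_mx 1 t)) in
  let x := fun l => t l ^+ 2 in
  ('C(n, j) * 'C(n, k))%:R * (F ^t* *m F) (inord (n - j)) (inord k) =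
  \sum_(0 <= r < j.+1)
    (k.+1 - j + 2 * r)%:R * (elem_sym x (k.+1 + r) * elem_sym x (j - r)).
Proof.
move=> t1 tp lejk lekn F x; rewrite -sum_elem_sym_avoidM //.
have t0 l : t l != 0 by rewrite -normr_eq0 t1 oner_eq0.
have tC l : (t l)^* = (t l)^-1.
  by apply: (mulfI (t0 l)); rewrite -normCK t1 expr1n divff.
have x0 l : x l != 0 by rewrite expf_neq0.
have xp : \prod_l x l = 1 by rewrite prodrXl tp expr1n.
rewrite mxE mulr_sumr; apply: eq_bigr => i _.
have -> : (F ^t*) (inord (n - j)) i = (F i (inord (n - j)))^* by rewrite mxE mxE.
rewrite natrM mulrACA /F.
have lejn : (j <= n)%N by apply: leq_trans lekn.
have := Phi0_entry i (inord k) t0 tp; rewrite inordK ?ltnS // => ->.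
have := Phi0_entry i (inord (n - j)) t0 tp; rewrite inordK ?ltnS ?leq_subr // bin_sub //.
move=> /(congr1 Num.conj); rewrite !rmorphM /= rmorph_nat => ->.
have -> : (elem_sym_avoid x i (n - j))^* = x i * elem_sym_avoid x i j.
  rewrite -[in RHS](subKn lejn) -elem_sym_avoidV ?leq_subr // rmorph_sum.
  apply: eq_bigr => S _; rewrite rmorph_prod; apply: eq_bigr => l _.
  by rewrite /= rmorphXn /= tC exprVn.
by rewrite tC /x; field; apply: t0.
Qed.

Lemma in_A_c_monomial (t : 'I_n.+1 -> C) :
  (forall l, `|t l| = 1) -> \prod_l t l = 1 ->
  in_A_c (monomial_mx 1 t, invmx (monomial_mx 1 t)).
Proof.
move=> t1 tp; have t0 l : t l != 0 by rewrite -normr_eq0 t1 oner_eq0.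
exists (monomial_mx 1 t); split=> //.
- by apply/is_diag_mxP => a b ab; rewrite mxE perm1 -val_eqE (negbTE ab).
- apply/unitarymxP.
  have -> : (monomial_mx 1 t) ^t* = invmx (monomial_mx 1 t).
    rewrite invmx_monomial1 //; apply/matrixP => a b; rewrite !mxE !perm1 eq_sym.
    case: eqP => [->|_]; last by rewrite !mulr0n rmorph0.
    by apply: (mulfI (t0 b)); rewrite !mulr1n -normCK t1 expr1n divff.
  rewrite mulmxV // unitmxE det_monomial_mx odd_perm1 tp mulr1.
  by rewrite unitr1.
- by rewrite det_monomial_mx odd_perm1 mul1r.
Qed.

(** The zonal functions involve only the squares of t, while density is stated in terms of x.
    Arbitrary square roots have product e with e^2 = 1, and multiplying one of them by e makes the
    product 1. *)
Lemma sqrt_torus (x : 'I_n.+1 -> C) :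
  (forall l, `|x l| = 1) -> \prod_l x l = 1 ->
  exists t : 'I_n.+1 -> C, [/\ forall l, `|t l| = 1, \prod_l t l = 1 &
    forall l, t l ^+ 2 = x l].
Proof.
move=> x1 xp; pose s l := sqrtC (x l); pose e := \prod_l s l.
have e2 : e ^+ 2 = 1.
  transitivity (\prod_l x l) => //; rewrite -prodrXl.
  by apply: eq_bigr => l _; apply: sqrtCK.
pose t (l : 'I_n.+1) := if l == ord0 then e * s l else s l.
have t2 l : t l ^+ 2 = x l.
  by rewrite /t; case: ifP => _; rewrite ?exprMn ?e2 ?mul1r sqrtCK.
exists t; split=> // [l|].
  by apply/eqP; rewrite -sqrp_eq1 ?normr_ge0 // -normrX t2 x1.
rewrite (bigD1 ord0) //= /t eqxx -mulrA.
transitivity (e ^+ 2) => //; rewrite expr2; congr (_ * _).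
rewrite /e [RHS](bigD1 ord0) //=; congr (_ * _).
by apply: eq_bigr => l /negbTE ->.
Qed.

(** Valid for every a: the default value 1 of [phi_var] is right at 0 and n+1, and beyond n+1 both
    sides vanish. *)
Lemma meval_phi_var (x : 'I_n.+1 -> C) a : \prod_l x l = 1 ->
  'C(n.+1, a)%:R *
    (phi_var R n a).@[fun l : 'I_n => 'C(n.+1, l.+1)%:R^-1 * elem_sym x l.+1] =
  elem_sym x a.
Proof.
move=> xp; case: a => [|a]; first by rewrite bin0 mul1r meval1 elem_sym0.
rewrite /phi_var; case: insubP => [l ltan lE|].
  by rewrite mevalXU lE mulVKf // pnatr_eq0 -lt0n bin_gt0 ltnS ltnW.
rewrite -leqNgt leq_eqVlt => /predU1P[<-|ltna].
  by rewrite binn mul1r meval1 elem_sym_full.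
by rewrite bin_small // mul0r elem_sym_gt.
Qed.

End SphericalFunctions.

Theorem theorem6p16 (R : realType) (n : nat) (hn : (1 <= n)%N)
    (J : forall m : 'I_n.+1, 'M[R[i]]_(V_dim n m.+1, n.+1))
    (hJ : forall m : 'I_n.+1, isometric_H_embedding (J m))
    (W : 'M[{mpoly R[i][n]}]_n.+1) (hW : is_Wpol J W)
    (j k : nat) (hj : (1 <= j)%N) (hjk : (j <= k)%N) (hk : (k <= n + 1)%N) :
  ('C(n, j - 1) * 'C(n, k - 1))%:R * entry1 W (n + 2 - j) k =
  \sum_(0 <= r < (minn (n + 1 - k) (j - 1)).+1)
    ((k + 1 - j + 2 * r) * 'C(n + 1, k + r) * 'C(n + 1, j - 1 - r))%:R
      * (phi_var R n (k + r) * phi_var R n (j - 1 - r)).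
Proof.
(* From here on j and k stand for the original indices minus 1. *)
case: j k hj hjk hk => // j [|k] // _ lejk lekn.
have {}lekn : (k <= n)%N by lia.
apply/eqP; rewrite -subr_eq0; apply/eqP.
(* By density, it is enough to evaluate the difference of the two sides at phi(a) for a in A_c. *)
apply: (@elem_sym_dense _ n (fun l => 'C(n.+1, l.+1)%:R^-1)) => [l|x x1 xp].
  by rewrite invr_eq0 pnatr_eq0 -lt0n bin_gt0 ltnS ltnW.
have [t [t1 tp t2]] := sqrt_torus x1 xp.
have ev (P : {mpoly R[i][n]}) :
    P.@[fun l : 'I_n => zonal l.+1 (monomial_mx 1 t, invmx (monomial_mx 1 t))] =
    P.@[fun l : 'I_n => 'C(n.+1, l.+1)%:R^-1 * elem_sym x l.+1].
  apply: meval_eq => l; congr (_ * _); apply: eq_bigr => S _.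
  by apply: eq_bigr => i _; rewrite /= mxE perm1 eqxx mulr1n t2.
have esE a : elem_sym (fun l => t l ^+ 2) a = elem_sym x a.
  by apply: eq_bigr => S _; apply: eq_bigr => i _.
have := hW _ (in_A_c_monomial t1 tp).
move/(congr1 (fun M : 'M_n.+1 => M (inord (n - j)) (inord k))).
rewrite [LHS]mxE ev => Wev.
have := @Gram_Phi0_entry _ _ _ hJ t j k t1 tp lejk lekn; rewrite /= -Wev => {Wev}.
rewrite mevalB mevalM raddfMn /= meval1 /entry1 !subn1 /=.
have -> : (n + 2 - j.+1).-1 = (n - j)%N by lia.
move=> ->; apply/eqP; rewrite subr_eq0; apply/eqP.
(* The Gram sum runs up to r = j; its terms with r > n-k contain an elementary symmetric function of
   degree above n+1, hence vanish. *)
rewrite raddf_sum /= [LHS](@big_cat_nat _ _ _ (minn (n + 1 - k.+1) j).+1) //=; last first.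
  by rewrite ltnS geq_minr.
rewrite [X in _ + X]big_nat_cond [X in _ + X]big1 ?addr0 => [|r /andP[rr _]]; last first.
  by rewrite [X in _ * (X * _)]esE elem_sym_gt ?mul0r ?mulr0 //; lia.
apply: eq_bigr => r _; rewrite !esE -!(meval_phi_var _ xp).
have -> : (k.+1 + 1 - j.+1 = k.+1 - j)%N by lia.
rewrite mevalM raddfMn /= meval1 mevalM (addn1 n) !natrM.
ring.
Qed.
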